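(* Let $G$ be a locally compact abelian group with Haar measure $m$, and let $\widehat{G}$ be its dual group with Haar measure $\widehat{m}$. Let $1\leq p\leq 2\leq q$. Let $S\subset G$ and $\Sigma\subset\widehat{G}$ be two sets of finite measure, and assume that $\Sigma$ satisfies a $(p,q)$-restriction estimate with constant $\rho_{p,q}(\Sigma)$, i.e. $$\left(\int_\Sigma|\widehat{f}(\xi)|^q\,\mathrm{d}\widehat{m}(\xi)\right)^{1/q}\leq \rho_{p,q}(\Sigma)\left(\int_G|f(x)|^p\,\mathrm{d}m(x)\right)^{1/p}\quad\text{for all } f\in\mathcal{S}(G)$$ (with supremum norms replacing the integrals if $q=\infty$). Assume that $$\rho_{p,q}(\Sigma)\,m(S)^{\frac1p-\frac12}\,\widehat{m}(\Sigma)^{\frac12-\frac1q}<1.$$ Then $(S,\Sigma)$ is a strong annihilating pair; more precisely, for every $f\in L^2(G)$, $$\|f\|_{L^2(G)}\leq A_{ann}(S,\Sigma)\bigl(\|f\|_{L^2(G\setminus S)}+\|\widehat{f}\|_{L^2(\widehat{G}\setminus\Sigma)}\bigr),\qquad A_{ann}(S,\Sigma)=\frac{1}{1-\rho_{p,q}(\Sigma)\,m(S)^{\frac1p-\frac12}\,\widehat{m}(\Sigma)^{\frac12-\frac1q}}.$$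
   Context: The Fourier transform of $f\in L^1(G)$ is $\widehat{f}(\chi)=c_G\int_G f(x)\overline{\chi(x)}\,\mathrm{d}m(x)$ for $\chi\in\widehat{G}$ (characters are continuous homomorphisms $G\to\{|z|=1\}$), where the normalization constant $c_G>0$ is chosen so that the Fourier transform extends to a unitary map $L^2(G)\to L^2(\widehat{G})$. $\mathcal{S}(G)\subset L^1(G)$ denotes a fixed class of functions that is dense in every $L^p(G)$, $1\leq p<\infty$, and such that $\widehat{f}$ is continuous for $f\in\mathcal{S}(G)$; the restriction estimate means the Fourier transform extends continuously $L^p(G)\to L^q(\Sigma)$ with the stated bound. A pair $(S,\Sigma)$ is a strong annihilating pair if there is a constant $C$ with $\|f\|_{L^2(G)}\leq C(\|f\|_{L^2(G\setminus S)}+\|\widehat f\|_{L^2(\widehat G\setminus\Sigma)})$ for all $f\in L^2(G)$. *)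

(* Defs.v *)
From HB Require Import structures.
From mathcomp Require Import all_boot all_order all_algebra.
From mathcomp Require Import all_classical all_reals all_analysis.
From mathcomp.real_closed Require Import complex.

Set Implicit Arguments.
Unset Strict Implicit.
Unset Printing Implicit Defensive.
Import Order.TTheory GRing.Theory Num.Theory.
Import numFieldNormedType.Exports.
Local Open Scope classical_set_scope.
Local Open Scope ring_scope.

Definition ptd (H : topologicalZmodType) : Type := H.
HB.instance Definition _ (H : topologicalZmodType) := Choice.on (ptd H).
HB.instance Definition _ (H : topologicalZmodType) := isPointed.Build (ptd H) (0 : H).
Notation borelT H := (@g_sigma_algebraType (ptd H) (@open H)).

Section Defs.
Variable R : realType.

Definition is_haar (H : topologicalZmodType)
  (mu : {measure set (borelT H) -> \bar R}) : Prop :=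
  [/\ (0 < mu setT)%E,
      forall (x : H) (A : set H), measurable (A : set (borelT H)) ->
        mu [set x + a | a in A] = mu A,
      forall K : set H, compact K -> (mu K < +oo)%E,
      forall A : set H, measurable (A : set (borelT H)) ->
        mu A = ereal_inf [set mu U | U in [set U : set H | open U /\ A `<=` U]]
    & forall U : set H, open U ->
        mu U = ereal_sup [set mu K | K in [set K : set H | compact K /\ K `<=` U]]].

Definition is_LCA (H : topologicalZmodType) : Prop :=
  hausdorff_space H /\ locally_compact [set: H].

Definition is_character (G : topologicalZmodType) (chi : G -> R[i]) : Prop :=
  [/\ forall x y, chi (x + y) = chi x * chi y,
      forall x, Normc.normc (chi x) = 1,
      continuous (fun x => complex.Re (chi x))
    & continuous (fun x => complex.Im (chi x))].

(* Gh, via ev, is the Pontryagin dual of G: ev is a bijection from Gh onto the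
   continuous characters of G, a group morphism (pointwise product), and the
   topology of Gh is the compact-open topology (uniform convergence on compacts). *)
Definition is_dual (G Gh : topologicalZmodType) (ev : Gh -> G -> R[i]) : Prop :=
  [/\ injective ev,
      forall xi, is_character (ev xi),
      forall chi, is_character chi -> exists xi, ev xi = chi,
      forall xi eta, ev (xi + eta) = (fun x => ev xi x * ev eta x)
    & forall (xi : Gh) (A : set Gh), nbhs xi A <->
        exists (K : set G) (eps : R), [/\ compact K, 0 < eps &
          [set eta | forall x, K x -> Normc.normc (ev eta x - ev xi x) < eps] `<=` A]].

Definition Lp_mem d (T : measurableType d) (mu : {measure set T -> \bar R})
  (p : \bar R) (f : T -> R[i]) : Prop :=
  [/\ measurable_fun setT (fun x => complex.Re (f x)),
      measurable_fun setT (fun x => complex.Im (f x))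
    & (Lnorm mu p (fun x => (Normc.normc (f x))%:E) < +oo)%E].

Definition cintegral d (T : measurableType d) (mu : {measure set T -> \bar R})
  (f : T -> R[i]) : R[i] :=
  Complex (Rintegral mu setT (fun x => complex.Re (f x)))
          (Rintegral mu setT (fun x => complex.Im (f x))).

Definition fourier (G Gh : topologicalZmodType) (ev : Gh -> G -> R[i])
  (m : {measure set (borelT G) -> \bar R}) (c : R) (f : G -> R[i]) (xi : Gh) : R[i] :=
  (c%:C * cintegral m (fun x => f x * conjc (ev xi x)))%C.

Definition is_L2_fourier (G Gh : topologicalZmodType) (ev : Gh -> G -> R[i])
  (m : {measure set (borelT G) -> \bar R}) (mh : {measure set (borelT Gh) -> \bar R})
  (c : R) (F2 : (G -> R[i]) -> (Gh -> R[i])) : Prop :=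
  [/\ forall f, Lp_mem m 2%:E f -> Lp_mem mh 2%:E (F2 f),
      forall f g, Lp_mem m 2%:E f -> Lp_mem m 2%:E g ->
        Lnorm mh 2%:E (fun xi => (Normc.normc (F2 f xi - F2 g xi))%:E) =
        Lnorm m 2%:E (fun x => (Normc.normc (f x - g x))%:E),
      forall h, Lp_mem mh 2%:E h ->
        exists2 f, Lp_mem m 2%:E f & {ae mh, forall xi, F2 f xi = h xi}
    & forall f, Lp_mem m 1%:E f -> Lp_mem m 2%:E f ->
        {ae mh, forall xi, F2 f xi = fourier ev m c f xi}].

Definition is_test_class (G Gh : topologicalZmodType) (ev : Gh -> G -> R[i])
  (m : {measure set (borelT G) -> \bar R}) (c : R) (Sc : set (G -> R[i])) : Prop :=
  [/\ forall f, Sc f -> Lp_mem m 1%:E f,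
      forall f, Sc f -> continuous (fun xi => complex.Re (fourier ev m c f xi)) /\
                        continuous (fun xi => complex.Im (fourier ev m c f xi)),
      forall (p : R) f, 1 <= p -> Sc f -> Lp_mem m p%:E f
    & forall (p : R) g (eps : R), 1 <= p -> 0 < eps -> Lp_mem m p%:E g ->
        exists2 f, Sc f &
          (Lnorm m p%:E (fun x => (Normc.normc (f x - g x))%:E) < eps%:E)%E].

Definition einv_exp (q : \bar R) : R :=
  match q with EFin r => r^-1 | _ => 0 end.

End Defs.

(* Main.v *)
(* Put g = f 1_S. Since F2 preserves distances,
     ||f|| = ||F2 f|| <= ||1_Sigma F2 g|| + ||f - g|| + ||1_(~ Sigma) F2 f||,
   so it suffices to bound ||1_Sigma F2 g||_2 by k ||f||_2, where k < 1 is the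
   constant of the hypothesis. Hoelder's inequality on Sigma and on S reduces this
   to the restriction estimate, but for g instead of a test function.
   Density of the test class is only available in each L^p separately, so let f_n be
   a test function with ||f_n - g||_p small and write f_n - g = h1 + h2, cutting at
   height 1. Then h1 is small in L^2 and h2 is small in L^1, hence F2 f_n - F2 g is
   the sum of a function small in L^2 and one that is uniformly small; both are
   small in L^2(Sigma) because Sigma has finite measure. *)
Require Import Defs.
From HB Require Import structures.
From mathcomp Require Import all_boot all_order all_algebra.
From mathcomp Require Import all_classical all_reals all_analysis.
From mathcomp.real_closed Require Import complex.
From mathcomp Require Import measurable_realfun ess_sup_inf ring lra.
Import Order.TTheory GRing.Theory Num.Theory.
Import numFieldNormedType.Exports.
Local Open Scope classical_set_scope.
Local Open Scope ring_scope.

(** * Norm inequalities for real functions: domination, Minkowski, Hoelder on a set of finite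
    measure *)

Lemma lee_poweR (R : realType) (a b : \bar R) (s : R) :
  (0 <= a)%E -> (a <= b)%E -> 0 < s -> (a `^ s <= b `^ s)%E.
Proof.
move=> a0 ab s0; apply: gt0_ler_poweR => //; first exact: ltW.
  by rewrite in_itv/= a0 leey.
by rewrite in_itv/= leey andbT (le_trans a0).
Qed.

Section RealLnorm.
Set Implicit Arguments.
Unset Strict Implicit.
Context d (T : measurableType d) (R : realType).
Variable mu : {measure set T -> \bar R}.
Implicit Types (u v w : T -> R) (p r : R) (A : set T).

Lemma measurable_normr_powR u p : measurable_fun setT u ->
  measurable_fun setT (fun x => `|u x| `^ p).
Proof.
move=> mu_; apply: (measurableT_comp (measurable_powR _)) => //.
exact: measurableT_comp.
Qed.

Lemma Lnorm_powRE u p :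
  (Lnorm mu p%:E (fun x => (u x)%:E) = (\int[mu]_x (`|u x| `^ p)%:E) `^ p^-1)%E.
Proof. by rewrite unlock. Qed.

Lemma Lnorm_le_ae u v p : 0 < p ->
  measurable_fun setT u -> measurable_fun setT v ->
  {ae mu, forall x, `|u x| <= `|v x|} ->
  (Lnorm mu p%:E (fun x => (u x)%:E) <= Lnorm mu p%:E (fun x => (v x)%:E))%E.
Proof.
move=> p0 um vm uv; rewrite !Lnorm_powRE; apply: lee_poweR.
- by apply: integral_ge0 => x _; rewrite lee_fin powR_ge0.
- apply: ae_ge0_le_integral => //.
  + by apply/measurable_EFinP; exact: measurable_normr_powR.
  + by apply/measurable_EFinP; exact: measurable_normr_powR.
  apply: filterS uv => x uvx _.
  by rewrite lee_fin ge0_ler_powR// ?nnegrE// ltW.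
- by rewrite invr_gt0.
Qed.

(** Minkowski is applied to |v| and |w|, followed by monotonicity of the norm. The domination is
    only asked almost everywhere because [F2] agrees with the Fourier integral only up to null
    sets. *)
Lemma Lnorm_leD_ae u v w p : 1 <= p ->
  measurable_fun setT u -> measurable_fun setT v -> measurable_fun setT w ->
  {ae mu, forall x, `|u x| <= `|v x| + `|w x|} ->
  (Lnorm mu p%:E (fun x => (u x)%:E) <=
   Lnorm mu p%:E (fun x => (v x)%:E) + Lnorm mu p%:E (fun x => (w x)%:E))%E.
Proof.
move=> p1 um vm wm uvw.
rewrite -[X in (X + _)%E]Lnorm_abse -[X in (_ + X)%E]Lnorm_abse.
apply: le_trans (minkowski_EFin mu _ _ p1); [|exact: measurableT_comp..].
apply: Lnorm_le_ae => //.
- exact: lt_le_trans p1.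
- by apply: measurable_funD; exact: measurableT_comp.
by apply: filterS uvw => x /= uvwx; rewrite [leRHS]ger0_norm// addr_ge0.
Qed.

Lemma Lnorm_cst_indic r A (k : R) : 0 < r -> measurable A -> 0 <= k ->
  (Lnorm mu r%:E (fun x => (k * \1_A x)%:E) = k%:E * mu A `^ r^-1)%E.
Proof.
move=> r0 mA k0.
rewrite Lnorm_powRE [X in (X `^ _)%E](_ : _ = (k `^ r)%:E * mu A)%E.
  rewrite poweRM ?lee_fin ?powR_ge0// poweR_EFin -powRrM mulfV ?gt_eqF//.
  by rewrite powRr1.
rewrite -[in RHS](setIT A) -integral_indic// -ge0_integralZl_EFin//.
- apply: eq_integral => x _; rewrite indicE; case: (x \in A).
    by rewrite mulr1 mule1 ger0_norm.
  by rewrite mulr0 mule0 normr0 powR0 ?gt_eqF.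
- by apply/measurable_EFinP; exact: measurable_indic.
- by rewrite powR_ge0.
Qed.

(** Hoelder on [A] with the conjugate exponents s/r and s/(s-r), applied to |1_A u|^r times 1_A. It
    serves twice: on S with exponents p <= 2, and on Sigma with exponents 2 <= q, where q may be
    infinite. *)
Lemma Lnorm_indic_le (r : R) (s : \bar R) A u :
  0 < r -> (r%:E <= s)%E -> measurable A -> (mu A < +oo)%E ->
  measurable_fun setT u ->
  (Lnorm mu s (fun x => (\1_A x * u x)%:E) < +oo)%E ->
  (Lnorm mu r%:E (fun x => (\1_A x * u x)%:E) <=
   (fine (mu A) `^ (r^-1 - einv_exp s))%:E *
   Lnorm mu s (fun x => (\1_A x * u x)%:E))%E.
Proof.
move=> r0 + mA Afin um.
have mi : measurable_fun setT (\1_A : T -> R) by exact: measurable_indic.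
have mAu : measurable_fun setT (fun x => \1_A x * u x).
  exact: measurable_funM.
have muA : mu A = (fine (mu A))%:E by rewrite fineK// ge0_fin_numE.
case: s => [s||//].
(* The case s = r is treated apart, since s/(s-r) is then not an exponent; the power of the measure
   is 0. *)
- rewrite lee_fin le_eqVlt => /predU1P[<- _|rs _].
    by rewrite /= subrr powRr0 mul1e.
  have s0 : 0 < s := lt_trans r0 rs.
  have sr : 0 < s - r by rewrite subr_gt0.
  have := @hoelder _ _ _ mu (fun x => `|\1_A x * u x| `^ r) (\1_A) (s / r) (s / (s - r)).
  move=> /(_ (measurable_normr_powR _ mAu) mi).
  rewrite !divr_gt0// => /(_ isT isT).
  have -> : (s / r)^-1 + (s / (s - r))^-1 = 1.
    by field; rewrite !gt_eqF.
  move=> /(_ erefl); rewrite [X in (_ <= _ * X)%E -> _](_ : _ = mu A `^ (s / (s - r))^-1)%E; last first.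
    rewrite -[RHS]mul1e -Lnorm_cst_indic ?divr_gt0//.
    by apply: eq_Lnorm => x; rewrite mul1r.
  rewrite Lnorm1 [X in (_ <= X * _)%E -> _](Lnorm_powRE _ (s / r)).
  under eq_integral.
    (* The extra factor 1_A is absorbed: it equals 1 wherever |1_A u|^r is nonzero. *)
    move=> x _; rewrite [abse _](_ : _ = (`|\1_A x * u x| `^ r)%:E); last first.
      rewrite /= ger0_norm ?mulr_ge0 ?powR_ge0// indicE; case: (x \in A).
        by rewrite mulr1.
      by rewrite !mul0r normr0 powR0 ?gt_eqF// mul0r.
    over.
  under [in X in (_ <= X * _)%E -> _]eq_integral.
    move=> x _; rewrite ger0_norm ?powR_ge0// -powRrM mulrCA divff ?gt_eqF// mulr1.
    over.
  (* Taking r-th roots turns the exponents r/s and (s-r)/s into 1/s and 1/r - 1/s. *)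
  move=> H; rewrite !Lnorm_powRE/=.
  apply: (@le_trans _ _ ((((\int[mu]_x (`|\1_A x * u x| `^ s)%:E) `^ (s / r)^-1 *
     mu A `^ (s / (s - r))^-1) `^ r^-1)%E)).
    rewrite gt0_ler_poweR ?invr_ge0 ?(ltW r0)//.
    - by rewrite in_itv/= leey andbT integral_ge0// => x _; rewrite lee_fin powR_ge0.
    - by rewrite in_itv/= leey andbT mule_ge0// poweR_ge0.
  rewrite poweRM ?poweR_ge0// -!poweRrM muleC.
  rewrite (_ : (s / r)^-1 / r = s^-1); last by field; rewrite !gt_eqF.
  rewrite (_ : _^-1 / r = r^-1 - s^-1); last by field; rewrite !gt_eqF.
  by rewrite {1}muA poweR_EFin.
- move=> _; rewrite /= subr0.
  set M := Lnorm mu +oo _ => Moo.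
  have M0 : (0 <= M)%E by exact: Lnorm_ge0.
  have MM : M = (fine M)%:E by rewrite fineK// ge0_fin_numE.
  have fM0 : 0 <= fine M by exact: fine_ge0.
  (* For s infinite, 1_A u is dominated almost everywhere by its essential supremum times 1_A, whose
     norm is explicit. *)
  have H : {ae mu, forall x, `|\1_A x * u x| <= `|fine M * \1_A x|}.
    have : {ae mu, forall x, `|\1_A x * u x| <= fine M}.
      move: (MM); rewrite /M unlock; case: ifPn => [_ E|].
        have := ess_sup_ge mu (abse \o (fun x => (\1_A x * u x)%:E)).
        by rewrite E; apply: filterS => x /=; rewrite lee_fin.
      (* If the whole space is null, the norm is not an essential supremum, but every property holds
         almost everywhere. *)
      rewrite -leNgt => T0 _; exists setT; split => //.
      by apply/eqP; rewrite eq_le T0 measure_ge0.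
    apply: filterS => x; rewrite indicE; case: (x \in A); rewrite !(mul0r,mulr0,mulr1)//.
    by move=> h; rewrite [leRHS]ger0_norm.
  apply: le_trans (Lnorm_le_ae r0 mAu _ H) _.
    by apply: measurable_funM => //; exact: measurable_indic.
  by rewrite Lnorm_cst_indic// {1}muA poweR_EFin muleC -MM.
Qed.

Lemma aeS (P Q : T -> Prop) : (forall x, P x -> Q x) ->
  {ae mu, forall x, P x} -> {ae mu, forall x, Q x}.
Proof. by move=> PQ; apply: filterS. Qed.

Lemma aeS3 (P1 P2 P3 Q : T -> Prop) : (forall x, P1 x -> P2 x -> P3 x -> Q x) ->
  {ae mu, forall x, P1 x} -> {ae mu, forall x, P2 x} ->
  {ae mu, forall x, P3 x} -> {ae mu, forall x, Q x}.
Proof. by move=> PQ; apply: filterS3. Qed.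

Lemma Lnorm_leD3_ae u v1 v2 v3 p : 1 <= p ->
  measurable_fun setT u -> measurable_fun setT v1 ->
  measurable_fun setT v2 -> measurable_fun setT v3 ->
  {ae mu, forall x, `|u x| <= `|v1 x| + `|v2 x| + `|v3 x|} ->
  (Lnorm mu p%:E (fun x => (u x)%:E) <=
   Lnorm mu p%:E (fun x => (v1 x)%:E) + Lnorm mu p%:E (fun x => (v2 x)%:E) +
   Lnorm mu p%:E (fun x => (v3 x)%:E))%E.
Proof.
move=> p1 um m1 m2 m3 uv.
have m12 : measurable_fun setT (fun x => `|v1 x| + `|v2 x|).
  by apply: measurable_funD; exact: measurableT_comp.
apply: le_trans (leeD (Lnorm_leD_ae p1 m12 m1 m2 _) (lexx _)).
  apply: Lnorm_leD_ae => //; apply: aeS uv => x uvx.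
  by rewrite (ger0_norm (addr_ge0 _ _)).
by apply: aeW => x; rewrite ger0_norm// addr_ge0.
Qed.

(** Integrating the pointwise bound gives an r-th moment of [w] at most e^p, and the r-th root gives
    the claim. This lets smallness in L^p pass to L^2 or L^1 for the two pieces cut at height 1. *)
Lemma Lnorm_le_powR u w p r (e : R) : 0 < p -> 0 < r -> 0 <= e ->
  measurable_fun setT u -> measurable_fun setT w ->
  (forall x, `|w x| `^ r <= `|u x| `^ p) ->
  (Lnorm mu p%:E (fun x => (u x)%:E) <= e%:E)%E ->
  (Lnorm mu r%:E (fun x => (w x)%:E) <= (e `^ (p / r))%:E)%E.
Proof.
move=> p0 r0 e0 um wm wu Ne.
have I0 (v : T -> R) s : (0 <= \int[mu]_x (`|v x| `^ s)%:E)%E.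
  by apply: integral_ge0 => x _; rewrite lee_fin powR_ge0.
rewrite powRrM -poweR_EFin Lnorm_powRE; apply: lee_poweR; rewrite ?invr_gt0//.
rewrite -poweR_EFin; apply: (@le_trans _ _ (\int[mu]_x (`|u x| `^ p)%:E)%E).
  apply: ge0_le_integral => //.
  - by apply/measurable_EFinP; exact: measurable_normr_powR.
  - by apply/measurable_EFinP; exact: measurable_normr_powR.
  - by move=> x _; rewrite lee_fin.
have := lee_poweR _ _ _ p (Lnorm_ge0 mu p%:E (fun x => (u x)%:E)) Ne p0.
by rewrite Lnorm_powRE -poweRrM mulVf ?gt_eqF// poweRe1.
Qed.

End RealLnorm.

(** * Complex-valued L^p functions and their integrals *)

Section ComplexLp.
Set Implicit Arguments.
Unset Strict Implicit.
Context d (T : measurableType d) (R : realType).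
Variable mu : {measure set T -> \bar R}.
Implicit Types (f g : T -> R[i]) (A : set T).

Definition cmeasurable f :=
  measurable_fun setT (fun x => complex.Re (f x)) /\
  measurable_fun setT (fun x => complex.Im (f x)).

Lemma normc_sqrtE (z : R[i]) :
  Normc.normc z = Num.sqrt (complex.Re z ^+ 2 + complex.Im z ^+ 2).
Proof. by case: z. Qed.

Lemma normc_ge0 (z : R[i]) : 0 <= Normc.normc z.
Proof. by rewrite normc_sqrtE sqrtr_ge0. Qed.

Lemma normc_conjc (z : R[i]) : Normc.normc (conjc z) = Normc.normc z.
Proof. by case: z => a b /=; rewrite sqrrN. Qed.

Lemma normc_real (a : R) : Normc.normc (a%:C)%C = `|a|.
Proof. by rewrite /= expr0n addr0 sqrtr_sqr. Qed.

Lemma normc_sub_triangle (x y : R[i]) :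
  Normc.normc x <= Normc.normc y + Normc.normc (x - y).
Proof. by apply: le_trans (le_normcD _ _); rewrite subrKC. Qed.

Lemma normc_subC (x y : R[i]) : Normc.normc (x - y) = Normc.normc (y - x).
Proof. by rewrite -normcN opprB. Qed.

Lemma ler_Re_normc (z : R[i]) : `|complex.Re z| <= Normc.normc z.
Proof. by rewrite normc_sqrtE -sqrtr_sqr ler_sqrt ?lerDl ?addr_ge0 ?sqr_ge0. Qed.

Lemma ler_Im_normc (z : R[i]) : `|complex.Im z| <= Normc.normc z.
Proof. by rewrite normc_sqrtE -sqrtr_sqr ler_sqrt ?lerDr ?addr_ge0 ?sqr_ge0. Qed.

Lemma normc_le_ReIm (z : R[i]) :
  Normc.normc z <= `|complex.Re z| + `|complex.Im z|.
Proof.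
rewrite normc_sqrtE -[leRHS]ger0_norm ?addr_ge0// -sqrtr_sqr ler_sqrt ?sqr_ge0//.
by rewrite sqrrD !real_normK ?num_real// addrAC lerDl mulrn_wge0 ?mulr_ge0.
Qed.

Lemma normc_indicM A f x :
  Normc.normc ((\1_A x)%:C%C * f x) = \1_A x * Normc.normc (f x).
Proof. by rewrite Normc.normcM normc_real ger0_norm// indicE. Qed.

Lemma measurable_normc f : cmeasurable f ->
  measurable_fun setT (fun x => Normc.normc (f x)).
Proof.
case=> mr mi.
under eq_fun do rewrite normc_sqrtE.
apply: (@measurableT_comp _ _ _ _ _ _ (@Num.sqrt R)).
  apply: continuous_measurable_fun; exact: sqrt_continuous.
by apply: measurable_funD; exact: measurable_funX.
Qed.

Lemma cmeasurableB f g : cmeasurable f -> cmeasurable g ->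
  cmeasurable (fun x => f x - g x).
Proof.
move=> [fr fi] [gr gi]; split.
  rewrite (_ : (fun _ => _) = fun x => complex.Re (f x) - complex.Re (g x)).
    exact: measurable_funB.
  by apply/funext => x; case: (f x) => a b; case: (g x).
rewrite (_ : (fun _ => _) = fun x => complex.Im (f x) - complex.Im (g x)).
  exact: measurable_funB.
by apply/funext => x; case: (f x) => a b; case: (g x).
Qed.

Lemma cmeasurableM f g : cmeasurable f -> cmeasurable g ->
  cmeasurable (fun x => f x * g x).
Proof.
move=> [fr fi] [gr gi]; split.
  rewrite (_ : (fun _ => _) = fun x => complex.Re (f x) * complex.Re (g x) -
                                       complex.Im (f x) * complex.Im (g x)).
    by apply: measurable_funB; exact: measurable_funM.
  by apply/funext => x; case: (f x) => a b; case: (g x).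
rewrite (_ : (fun _ => _) = fun x => complex.Re (f x) * complex.Im (g x) +
                                     complex.Im (f x) * complex.Re (g x)).
  by apply: measurable_funD; exact: measurable_funM.
by apply/funext => x; case: (f x) => a b; case: (g x).
Qed.

Lemma cmeasurable_conjc f : cmeasurable f -> cmeasurable (fun x => conjc (f x)).
Proof.
move=> [fr fi]; split.
  rewrite (_ : (fun _ => _) = fun x => complex.Re (f x))//.
  by apply/funext => x; case: (f x).
rewrite (_ : (fun _ => _) = fun x => - complex.Im (f x)).
  exact: measurable_funN.
by apply/funext => x; case: (f x).
Qed.

Lemma cmeasurable_indic A : measurable A -> cmeasurable (fun x => (\1_A x)%:C%C).
Proof. by move=> mA; split; [exact: measurable_indic|exact: measurable_cst]. Qed.

Lemma cmeasurable_indicM A f : measurable A -> cmeasurable f ->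
  cmeasurable (fun x => (\1_A x)%:C%C * f x).
Proof. by move=> mA mf; apply: cmeasurableM => //; exact: cmeasurable_indic. Qed.

Lemma Lp_mem_cmeasurable p f : Lp_mem mu p f -> cmeasurable f.
Proof. by case. Qed.

Lemma Lp_memP p f : cmeasurable f ->
  (Lnorm mu p (fun x => (Normc.normc (f x))%:E) < +oo)%E -> Lp_mem mu p f.
Proof. by case. Qed.

Lemma Lp_mem_fineK p f : Lp_mem mu p f ->
  ((fine (Lnorm mu p (fun x => (Normc.normc (f x))%:E)))%:E =
   Lnorm mu p (fun x => (Normc.normc (f x))%:E))%E.
Proof. by case=> _ _ h; rewrite fineK// ge0_fin_numE ?Lnorm_ge0. Qed.

Lemma Lp_mem0 p : (p != 0)%E -> Lp_mem mu p (fun=> 0).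
Proof.
move=> p0; apply: Lp_memP; first by split; exact: measurable_cst.
by under eq_Lnorm do rewrite Normc.normc0; rewrite [X in (X < _)%E]Lnorm0.
Qed.

Lemma Lp_mem_le (p : R) f g : 0 < p -> cmeasurable f -> Lp_mem mu p%:E g ->
  (forall x, Normc.normc (f x) <= Normc.normc (g x)) -> Lp_mem mu p%:E f.
Proof.
move=> p0 mf gp fg; apply: Lp_memP => //.
case: (gp) => _ _; apply: le_lt_trans; apply: Lnorm_le_ae => //.
- exact: measurable_normc.
- by apply: measurable_normc; exact: Lp_mem_cmeasurable gp.
- by apply: aeW => x; rewrite !ger0_norm ?normc_ge0.
Qed.

Lemma Lp_mem_indicM (p : R) A f : 0 < p -> measurable A -> Lp_mem mu p%:E f ->
  Lp_mem mu p%:E (fun x => (\1_A x)%:C%C * f x).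
Proof.
move=> p0 mA fp; have mf := Lp_mem_cmeasurable fp.
apply: Lp_mem_le fp _ => //; first exact: cmeasurable_indicM.
move=> x; rewrite normc_indicM indicE ler_piMl ?normc_ge0//.
by case: (_ \in _).
Qed.

Lemma Lp_memB (p : R) f g : 1 <= p -> Lp_mem mu p%:E f -> Lp_mem mu p%:E g ->
  Lp_mem mu p%:E (fun x => f x - g x).
Proof.
move=> p1 [fr fi fp] [gr gi gp]; have mfg := cmeasurableB (conj fr fi) (conj gr gi).
apply: Lp_memP => //.
apply: (@le_lt_trans _ _ (Lnorm mu p%:E (fun x => (Normc.normc (f x))%:E) +
   Lnorm mu p%:E (fun x => (Normc.normc (g x))%:E))%E); last exact: lte_add_pinfty.
apply: Lnorm_leD_ae => //; [exact: measurable_normc..|].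
apply: aeW => x; rewrite !ger0_norm ?normc_ge0//.
by rewrite -(normcN (g x)) le_normcD.
Qed.

(** Finite measure of [A] makes the exponents nested. Hence f 1_S lies in L^1 and L^p as soon as f
    is in L^2, so its transform is given by the integral formula. *)
Lemma Lp_mem_indic_le (r s : R) A f : 0 < r -> r <= s -> measurable A ->
  (mu A < +oo)%E -> Lp_mem mu s%:E f ->
  Lp_mem mu r%:E (fun x => (\1_A x)%:C%C * f x).
Proof.
move=> r0 rs mA Afin fs; have mf := Lp_mem_cmeasurable fs.
apply: Lp_memP; first exact: cmeasurable_indicM.
have [_ _] := Lp_mem_indicM (lt_le_trans r0 rs) mA fs.
under [X in (X < _)%E -> _]eq_Lnorm do rewrite normc_indicM.
move=> sfin; under eq_Lnorm do rewrite normc_indicM.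
have rsE : (r%:E <= s%:E)%E by rewrite lee_fin.
apply: le_lt_trans (Lnorm_indic_le r0 rsE mA Afin (measurable_normc mf) sfin) _.
by rewrite lte_mul_pinfty// lee_fin powR_ge0.
Qed.

Lemma Lp_mem1_integrable f : Lp_mem mu 1%:E f ->
  mu.-integrable setT (EFin \o (fun x => complex.Re (f x))) /\
  mu.-integrable setT (EFin \o (fun x => complex.Im (f x))).
Proof.
move=> [fr fi]; rewrite Lnorm1 => f1.
have f1' : mu.-integrable setT (fun x => (Normc.normc (f x))%:E).
  apply/integrableP; split => //.
  by apply/measurable_EFinP; exact: measurable_normc.
split; apply: le_integrable f1' => //; try exact/measurable_EFinP.
- by move=> x _ /=; rewrite lee_fin [leRHS]ger0_norm ?normc_ge0 ?ler_Re_normc.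
- by move=> x _ /=; rewrite lee_fin [leRHS]ger0_norm ?normc_ge0 ?ler_Im_normc.
Qed.

Lemma cintegralB f g : Lp_mem mu 1%:E f -> Lp_mem mu 1%:E g ->
  cintegral mu (fun x => f x - g x) = cintegral mu f - cintegral mu g.
Proof.
move=> /Lp_mem1_integrable [fr fi] /Lp_mem1_integrable [gr gi].
rewrite /cintegral [RHS](_ : _ = Complex
  (Rintegral mu setT (fun x => complex.Re (f x)) -
   Rintegral mu setT (fun x => complex.Re (g x)))
  (Rintegral mu setT (fun x => complex.Im (f x)) -
   Rintegral mu setT (fun x => complex.Im (g x))))//.
rewrite -!RintegralB//; congr Complex; apply: eq_Rintegral => x _.
  by case: (f x) => a b; case: (g x).
by case: (f x) => a b; case: (g x).
Qed.

(* The factor 2 spares the rotation argument and is harmless in the limit. *)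
Lemma normc_cintegral_le f (e : R) : Lp_mem mu 1%:E f ->
  (Lnorm mu 1%:E (fun x => (Normc.normc (f x))%:E) <= e%:E)%E ->
  Normc.normc (cintegral mu f) <= 2 * e.
Proof.
move=> f1 fe; have [fr fi] := Lp_mem1_integrable f1.
have mf := Lp_mem_cmeasurable f1.
have part (u : T -> R) : mu.-integrable setT (EFin \o u) ->
    (forall x, `|u x| <= Normc.normc (f x)) -> `|Rintegral mu setT u| <= e.
  move=> ui uf; rewrite -lee_fin; apply: le_trans fe.
  rewrite EFin_normr_Rintegral// Lnorm1.
  have /integrableP[um _] := ui.
  apply: le_trans (le_abse_integral _ measurableT um) _ => //.
  apply: ge0_le_integral => //.
  - exact: measurableT_comp.
  - apply: measurableT_comp => //; apply/measurable_EFinP; exact: measurable_normc.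
  - by move=> x _ /=; rewrite lee_fin [leRHS]ger0_norm ?normc_ge0.
apply: le_trans (normc_le_ReIm _) _; rewrite mulr_natl mulr2n lerD//=.
  by apply: part => // x; exact: ler_Re_normc.
by apply: part => // x; exact: ler_Im_normc.
Qed.

End ComplexLp.

(** * The Fourier transform on L^1 and on L^2 *)

Lemma continuous_borel_measurable (R : realType) (H : topologicalZmodType)
    (u : H -> R) :
  continuous u -> measurable_fun setT (u : borelT H -> R).
Proof.
move=> /continuousP cu.
apply: (measurability _ (RGenOpens.measurableE R)) => _ [_ [a [b ->]] <-].
by rewrite setTI; apply: sub_sigma_algebra; apply: cu; exact: interval_open.
Qed.

Section FourierEstimates.
Set Implicit Arguments.
Unset Strict Implicit.
Context (R : realType) (G Gh : topologicalZmodType).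
Variables (ev : Gh -> G -> R[i]).
Variables (m : {measure set (borelT G) -> \bar R}).
Variables (mh : {measure set (borelT Gh) -> \bar R}).
Variables (c : R) (F2 : (G -> R[i]) -> (Gh -> R[i])).
Hypotheses (ev_char : forall xi, is_character (ev xi)) (c_gt0 : 0 < c).
Hypothesis (F2P : is_L2_fourier ev m mh c F2).
Implicit Types (f g h : G -> R[i]).

Local Notation Nm p f := (Lnorm m p (fun x => (Normc.normc (f x))%:E)).
Local Notation Nh p f := (Lnorm mh p (fun x => (Normc.normc (f x))%:E)).

Lemma Lp_mem_conjc_char (p : R) f xi : 0 < p -> Lp_mem m p%:E f ->
  Lp_mem m p%:E (fun x => f x * conjc (ev xi x)).
Proof.
move=> p0 fp; apply: (Lp_mem_le p0 _ fp).
  apply: cmeasurableM; first exact: Lp_mem_cmeasurable fp.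
  apply: cmeasurable_conjc; have [_ _ cr ci] := ev_char xi.
  by split; exact: continuous_borel_measurable.
by move=> x; have [_ n1 _ _] := ev_char xi; rewrite Normc.normcM normc_conjc n1 mulr1.
Qed.

(** With [f] a test function, [g] its target and [h] the L^2-small piece of f - g, this bounds
    uniformly the transform of the L^1-small remainder. It is phrased with Fourier integrals, which
    are linear on L^1, whereas additivity is not among the properties listed in [is_L2_fourier]. *)
Lemma fourier_sub_le f g h (e : R) xi :
  Lp_mem m 1%:E f -> Lp_mem m 1%:E g -> Lp_mem m 1%:E h ->
  (Nm 1%:E (fun x => (f x - g x - h x)%R) <= e%:E)%E ->
  Normc.normc (fourier ev m c f xi - fourier ev m c g xi - fourier ev m c h xi)
    <= 2 * c * e.
Proof.
move=> f1 g1 h1 He.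
rewrite /fourier -!mulrBr -!cintegralB; last first.
- exact: Lp_mem_conjc_char.
- exact: Lp_mem_conjc_char.
- exact: Lp_mem_conjc_char.
- by apply: Lp_memB => //; exact: Lp_mem_conjc_char.
rewrite Normc.normcM normc_real gtr0_norm// (mulrC 2) -mulrA ler_pM2l//.
rewrite (_ : (fun _ => _) = fun x => (f x - g x - h x) * conjc (ev xi x)); last first.
  by apply/funext => x; rewrite !mulrBl.
apply: normc_cintegral_le.
  by apply: Lp_mem_conjc_char => //; do 2!apply: Lp_memB => //.
apply: le_trans He; have [_ n1 _ _] := ev_char xi.
by under eq_Lnorm do rewrite Normc.normcM normc_conjc n1 mulr1.
Qed.

(** Preservation of distances is applied to the pair f, 0. The zero function is in both L^1 and L^2,
    so the integral formula forces F2 0 = 0 almost everywhere. *)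
Lemma L2_fourier_norm f : Lp_mem m 2%:E f -> Nh 2%:E (F2 f) = Nm 2%:E f.
Proof.
move=> f2; have [F2mem F2iso _ F2eq] := F2P.
have z2 : Lp_mem m 2%:E (fun=> 0 : R[i]) by apply: Lp_mem0; rewrite eqe pnatr_eq0.
have z1 : Lp_mem m 1%:E (fun=> 0 : R[i]) by apply: Lp_mem0; rewrite eqe oner_eq0.
have F20 : {ae mh, forall xi, F2 (fun=> 0) xi = 0}.
  apply: aeS (F2eq _ z1 z2) => xi ->; rewrite /fourier /cintegral.
  rewrite (_ : Complex _ _ = 0) ?mulr0//; apply: (congr2 (@Complex R));
    by rewrite /Rintegral (eq_integral (cst 0%E)) ?integral0// => x _; rewrite mul0r.
have mF := Lp_mem_cmeasurable (F2mem _ f2).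
have mF0 := Lp_mem_cmeasurable (F2mem _ z2).
have := F2iso _ _ f2 z2; under [X in _ = X -> _]eq_Lnorm do rewrite subr0.
move=> <-; apply/eqP; rewrite eq_le; apply/andP; split; apply: Lnorm_le_ae => //;
  try exact: measurable_normc; try (apply: measurable_normc; exact: cmeasurableB);
  by apply: aeS F20 => xi ->; rewrite subr0.
Qed.

(* [h1] is the restriction of [h] to the set where [|h| <= 1]: there
   [|h|^2 <= |h|^p], and [|h| <= |h|^p] off that set. *)
Lemma L1_L2_split (p e : R) h : 1 <= p <= 2 -> 0 <= e ->
  Lp_mem m p%:E h -> Lp_mem m 1%:E h -> (Nm p%:E h <= e%:E)%E ->
  exists h1, [/\ Lp_mem m 1%:E h1, Lp_mem m 2%:E h1,
    (Nm 2%:E h1 <= (e `^ (p / 2))%:E)%E &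
    (Nm 1%:E (fun x => (h x - h1 x)%R) <= (e `^ p)%:E)%E].
Proof.
move=> /andP[p1 p2] e0 hp h1 he; have mh_ := Lp_mem_cmeasurable hp.
have p0 : 0 < p by exact: lt_le_trans p1.
have mn := measurable_normc mh_.
pose B : set (borelT G) := [set x | Normc.normc (h x) <= 1].
have mB : measurable B.
  rewrite (_ : B = setT `&` (fun x => Normc.normc (h x)) @^-1` `]-oo, 1]).
    by apply: mn => //; exact: measurable_itv.
  by rewrite setTI; apply/seteqP; split=> x /=; rewrite in_itv.
pose k x : R[i] := (\1_B x)%:C%C * h x.
have mk : @cmeasurable _ (borelT G) R k by exact: cmeasurable_indicM.
have k1 : Lp_mem m 1%:E k by exact: Lp_mem_indicM.
have k2 : (Nm 2%:E k <= (e `^ (p / 2))%:E)%E.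
  apply: Lnorm_le_powR he => //; first exact: measurable_normc.
  move=> x; rewrite /k normc_indicM indicE !ger0_norm ?mulr_ge0 ?normc_ge0//.
  have [/set_mem xB|_] := boolP (x \in B); last by rewrite mul0r powR0 ?powR_ge0 ?pnatr_eq0.
  (* The powers t^a decrease in a for 0 < t <= 1; the value t = 0 is checked separately. *)
  rewrite mul1r; have [->|n0] := eqVneq (Normc.normc (h x)) 0.
    by rewrite !powR0// ?gt_eqF.
  by rewrite ger_powR// lt0r n0 normc_ge0.
exists k; split => //.
  by apply: Lp_memP => //; apply: le_lt_trans k2 _; rewrite ltry.
(* Writing p as p/1 gives the bound the shape of [Lnorm_le_powR] with r = 1. *)
rewrite -[p in X in (_ <= X)%E]divr1; apply: Lnorm_le_powR he => //.
  by apply: measurable_normc; exact: cmeasurableB.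
move=> x; rewrite /k indicE !ger0_norm ?normc_ge0//.
have [_|/negP xB] := boolP (x \in B).
  by rewrite mul1r subrr Normc.normc0 powR0 ?powR_ge0 ?oner_eq0.
rewrite mul0r subr0 ler_powR// ltW// ltNge; apply/negP => hx.
by apply: xB; rewrite inE.
Qed.

End FourierEstimates.

(** * From the restriction estimate on test functions to an L^2(Sigma) bound *)

Section Restriction.
Set Implicit Arguments.
Unset Strict Implicit.
Context (R : realType) (G Gh : topologicalZmodType).
Variables (ev : Gh -> G -> R[i]).
Variables (m : {measure set (borelT G) -> \bar R}).
Variables (mh : {measure set (borelT Gh) -> \bar R}).
Variables (c : R) (F2 : (G -> R[i]) -> (Gh -> R[i])) (Sc : set (G -> R[i])).
Hypotheses (ev_char : forall xi, is_character (ev xi)) (c_gt0 : 0 < c).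
Hypothesis (F2P : is_L2_fourier ev m mh c F2).
Hypothesis (ScP : is_test_class ev m c Sc).
Variables (p : R) (q : \bar R) (Sigma : set Gh) (rho : R).
Hypotheses (p12 : 1 <= p <= 2) (q2 : (2%:E <= q)%E).
Hypothesis (mSigma : measurable (Sigma : set (borelT Gh))).
Hypotheses (Sigmafin : (mh Sigma < +oo)%E) (rho0 : 0 <= rho).
Hypothesis restriction : forall f, Sc f ->
  (Lnorm mh q (fun xi => (\1_Sigma xi * Normc.normc (fourier ev m c f xi))%:E)
    <= rho%:E * Lnorm m p%:E (fun x => (Normc.normc (f x))%:E))%E.

Local Notation Nm p f := (Lnorm m p (fun x => (Normc.normc (f x))%:E)).
Local Notation NSigma p f :=
  (Lnorm mh p (fun xi => (\1_Sigma xi * Normc.normc (f xi))%:E)).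
Local Notation K := (fine (mh Sigma) `^ (2^-1 - einv_exp q)).

(** Hoelder on Sigma lowers the exponent q to 2 at the cost of the factor [K]. Continuity of the
    transform of a test function provides measurability. *)
Lemma test_restriction_L2 f : Sc f ->
  (NSigma 2%:E (fourier ev m c f) <= (rho * K)%:E * Nm p%:E f)%E.
Proof.
move=> Sf; have [_ Sc_cont Sc_Lp _] := ScP.
have /andP[p1 _] := p12; have fp := Sc_Lp _ _ p1 Sf.
have mf : @cmeasurable _ (borelT Gh) R (fourier ev m c f).
  by have [? ?] := Sc_cont _ Sf; split; exact: continuous_borel_measurable.
have rf := restriction Sf.
have rfin : (NSigma q (fourier ev m c f) < +oo)%E.
  apply: le_lt_trans rf _; rewrite lte_mul_pinfty// ?lee_fin//.
  by have [] := fp.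
apply: le_trans (Lnorm_indic_le _ q2 mSigma Sigmafin (measurable_normc mf) rfin) _ => //.
by rewrite mulrC EFinM -muleA; apply: lee_wpmul2l; rewrite ?lee_fin ?powR_ge0.
Qed.

(** The three error terms have separate sources: rho K t from replacing the L^p norm of the test
    function by that of [g], t from the L^2-small piece, and the last from the uniformly small
    transform integrated over Sigma. *)
Lemma restriction_L2_approx g (t : R) : 0 < t <= 1 ->
  Lp_mem m 1%:E g -> Lp_mem m 2%:E g -> Lp_mem m p%:E g ->
  (NSigma 2%:E (F2 g) <= (rho * K)%:E * Nm p%:E g +
     (t * (rho * K + 1 + 2 * c * fine (mh Sigma) `^ 2^-1))%:E)%E.
Proof.
move=> /andP[t0 t1] g1 g2 gp.
have [F2mem _ _ F2eq] := F2P; have [Sc_L1 _ Sc_Lp Sc_dense] := ScP.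
have /andP[p1 p2] := p12; have p0 : 0 < p by exact: lt_le_trans p1.
(* Precision t^2 is chosen so that both bounds of [L1_L2_split] drop below t: they are t^p and
   t^(2p), with p >= 1 and t <= 1. *)
have [f Sf fg] := Sc_dense p g (t ^+ 2) p1 (exprn_gt0 2 t0) gp.
have f1 := Sc_L1 _ Sf; have f2 := Sc_Lp 2 f (ler1n _ 2) Sf.
have fp := Sc_Lp p f p1 Sf.
have mf := Lp_mem_cmeasurable f1; have mg := Lp_mem_cmeasurable g1.
have t_pow a : 1 <= a *+ 2 -> (t ^+ 2) `^ a <= t.
  move=> a2; rewrite -powR_mulrn ?(ltW t0)// -powRrM mulr_natl.
  by rewrite -[leRHS]powRr1 ?(ltW t0)// ger_powR ?t0.
have [h1 [k1 k2 Nk2 Nk1]] := L1_L2_split p12 (sqr_ge0 t) (Lp_memB p1 fp gp)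
  (Lp_memB (lexx _) f1 g1) (ltW fg).
have {}Nk2 : (Nm 2%:E h1 <= t%:E)%E.
  apply: le_trans Nk2 _; rewrite lee_fin t_pow// -mulr_natr; lra.
have {}Nk1 : (Nm 1%:E (fun x => (f x - g x - h1 x)%R) <= t%:E)%E.
  by apply: le_trans Nk1 _; rewrite lee_fin t_pow// -mulr_natr; lra.
have mF u : Lp_mem m 2%:E u ->
    measurable_fun setT (fun xi : borelT Gh => Normc.normc (F2 u xi)).
  by move=> u2; apply: measurable_normc; exact: Lp_mem_cmeasurable (F2mem _ u2).
have mi : measurable_fun setT (\1_Sigma : borelT Gh -> R) by exact: measurable_indic.
have mfourier : measurable_fun setT
    (fun xi : borelT Gh => Normc.normc (fourier ev m c f xi)).
  have [_ Sc_cont _ _] := ScP; have [? ?] := Sc_cont _ Sf.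
  by apply: measurable_normc; split; exact: continuous_borel_measurable.
(* On Sigma the transform of g is at most that of f, plus that of h1, plus that of f - g - h1, in
   modulus; the last is at most 2 c t. Off Sigma the left side vanishes, so the second term can keep
   its full norm, which the isometry computes. *)
have step : (NSigma 2%:E (F2 g) <= NSigma 2%:E (fourier ev m c f) +
    Lnorm mh 2%:E (fun xi => (Normc.normc (F2 h1 xi))%:E) +
    Lnorm mh 2%:E (fun xi => (2 * c * t * \1_Sigma xi)%:E))%E.
  apply: Lnorm_leD3_ae => //; first exact: ler1n.
  - by apply: measurable_funM => //; exact: mF.
  - exact: measurable_funM.
  - exact: mF.
  - exact: measurable_funM.
  apply: aeS3 (F2eq _ f1 f2) (F2eq _ g1 g2) (F2eq _ k1 k2) => xi Ef Eg Eh.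
  rewrite Eg Eh !ger0_norm ?mulr_ge0 ?normc_ge0 ?(ltW c_gt0) ?(ltW t0)//.
  have := fourier_sub_le ev_char c_gt0 xi f1 g1 k1 Nk1.
  rewrite indicE; case: (xi \in Sigma); last first.
    by rewrite !mul0r mulr0 add0r addr0 normc_ge0.
  rewrite !mul1r mulr1.
  set F := fourier _ _ _ f xi; set Gx := fourier _ _ _ g xi.
  set H := fourier _ _ _ h1 xi => le3.
  have := normc_sub_triangle Gx F; rewrite normc_subC => le1.
  by have := normc_sub_triangle (F - Gx) H; lra.
apply: le_trans step _.
rewrite (L2_fourier_norm F2P k2).
have Nc : (Lnorm mh 2%:E (fun xi => (2 * c * t * \1_Sigma xi)%:E) =
    (2 * c * t * fine (mh Sigma) `^ 2^-1)%:E)%E.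
  have k0 : 0 <= 2 * c * t by rewrite !mulr_ge0// ltW.
  by rewrite Lnorm_cst_indic// -[X in (_ * X `^ _)%E](@fineK _ (mh Sigma)) ?ge0_fin_numE// poweR_EFin.
rewrite Nc; have Nf : (Nm p%:E f <= Nm p%:E g + t%:E)%E.
  have tt : ((t ^+ 2)%:E <= t%:E)%E by rewrite lee_fin expr2 ler_piMl ?(ltW t0).
  apply: le_trans (leeD (lexx _) (le_trans (ltW fg) tt)).
  apply: Lnorm_leD_ae => //; try exact: measurable_normc.
    by apply: measurable_normc; exact: cmeasurableB.
  by apply: aeW => x; rewrite !ger0_norm ?normc_ge0// normc_sub_triangle.
have := test_restriction_L2 Sf.
have rK0 : 0 <= rho * K by rewrite mulr_ge0 ?powR_ge0.
have := lee_wpmul2l (_ : (0 <= (rho * K)%:E)%E) Nf; rewrite lee_fin => /(_ rK0).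
rewrite -(Lp_mem_fineK gp) -(Lp_mem_fineK fp) -EFinD -!EFinM.
move: Nk2; rewrite -(Lp_mem_fineK k2) !lee_fin => Nk2 le1 le2.
apply: le_trans (leeD (leeD le2 (lexx _)) (lexx _)) _.
rewrite -!EFinD lee_fin; move: le1 Nk2.
set A := fine _; set B := fine _; set C := fine _; set D := fine _ `^ 2^-1.
set E := rho * K; nra.
Qed.

(** The error in [restriction_L2_approx] is t times a coefficient independent of t, so it can be
    made at most any given e > 0. *)
Lemma restriction_L2 g :
  Lp_mem m 1%:E g -> Lp_mem m 2%:E g -> Lp_mem m p%:E g ->
  (NSigma 2%:E (F2 g) <= (rho * K)%:E * Nm p%:E g)%E.
Proof.
move=> g1 g2 gp; apply/lee_addgt0Pr => e e0.
set C := rho * K + 1 + 2 * c * fine (mh Sigma) `^ 2^-1.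
have C0 : 0 < C.
  rewrite /C ltr_pwDl// ?mulr_ge0 ?powR_ge0// ?(ltW c_gt0)//.
  by rewrite ltr_wpDl// mulr_ge0 ?powR_ge0.
(* The bound by 1 meets the range required of t, and t <= e / C makes the error t C at most e. *)
pose t := Num.min 1 (e / C).
have t01 : 0 < t <= 1 by rewrite /t lt_min ltr01 divr_gt0//= ge_min lexx.
apply: le_trans (restriction_L2_approx t01 g1 g2 gp) _.
rewrite leeD2l// lee_fin -/C -ler_pdivlMr//.
by rewrite /t ge_min lexx orbT.
Qed.

End Restriction.

(** * The inequality for the annihilating pair *)

Theorem theorem2p1 (R : realType) (G Gh : topologicalZmodType)
  (ev : Gh -> G -> R[i])
  (m : {measure set (borelT G) -> \bar R})
  (mh : {measure set (borelT Gh) -> \bar R})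
  (c : R) (F2 : (G -> R[i]) -> (Gh -> R[i])) (Sc : set (G -> R[i]))
  (p : R) (q : \bar R) (S : set G) (Sigma : set Gh) (rho : R) :
  is_LCA G -> is_dual ev -> is_haar m -> is_haar mh ->
  0 < c -> is_L2_fourier ev m mh c F2 -> is_test_class ev m c Sc ->
  1 <= p <= 2 -> (2%:E <= q)%E ->
  measurable (S : set (borelT G)) -> (m S < +oo)%E ->
  measurable (Sigma : set (borelT Gh)) -> (mh Sigma < +oo)%E ->
  0 <= rho ->
  (forall f, Sc f ->
     (Lnorm mh q (fun xi => (\1_Sigma xi * Normc.normc (fourier ev m c f xi))%:E)
      <= rho%:E * Lnorm m p%:E (fun x => (Normc.normc (f x))%:E))%E) ->
  rho * fine (m S) `^ (p^-1 - 2^-1) * fine (mh Sigma) `^ (2^-1 - einv_exp q) < 1 ->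
  forall f, Lp_mem m 2%:E f ->
    (Lnorm m 2%:E (fun x => (Normc.normc (f x))%:E) <=
     ((1 - rho * fine (m S) `^ (p^-1 - 2^-1)
             * fine (mh Sigma) `^ (2^-1 - einv_exp q))^-1)%:E *
     (Lnorm m 2%:E (fun x => (\1_(~` S) x * Normc.normc (f x))%:E) +
      Lnorm mh 2%:E (fun xi => (\1_(~` Sigma) xi * Normc.normc (F2 f xi))%:E)))%E.
Proof.
move=> _ [_ ev_char _ _ _] _ _ c0 F2P ScP p12 q2 mS Sfin mSigma Sigmafin rho0.
move=> restriction k1 f f2.
have /andP[p1 p2] := p12; have p0 : 0 < p by exact: lt_le_trans p1.
set kS := fine (m S) `^ _; set kSigma := fine (mh Sigma) `^ _.
move: k1; rewrite -/kS -/kSigma => k1.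
pose g x : R[i] := (\1_S x)%:C%C * f x.
have g1 : Lp_mem m 1%:E g by apply: Lp_mem_indic_le f2 => //; exact: ler1n.
have gp : Lp_mem m p%:E g by exact: Lp_mem_indic_le f2.
have g2 : Lp_mem m 2%:E g by exact: Lp_mem_indicM.
have [F2mem F2iso _ _] := F2P.
have F2f := F2mem _ f2; have F2g := F2mem _ g2.
have mF2f := measurable_normc (Lp_mem_cmeasurable F2f).
have mF2g := measurable_normc (Lp_mem_cmeasurable F2g).
have mn := measurable_normc (Lp_mem_cmeasurable f2).
have mS1 : measurable_fun setT (\1_S : borelT G -> R) by exact: measurable_indic.
have mSigma1 : measurable_fun setT (\1_Sigma : borelT Gh -> R).
  exact: measurable_indic.
have mSigmaC : measurable_fun setT (\1_(~` Sigma) : borelT Gh -> R).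
  by apply: measurable_indic; exact: measurableC.
set a := Lnorm m 2%:E _; set b := Lnorm m 2%:E _; set e := Lnorm mh 2%:E _.
have norm_g : (Lnorm m p%:E (fun x => (Normc.normc (g x))%:E) <= kS%:E * a)%E.
  under eq_Lnorm do rewrite normc_indicM.
  have /Lp_mem_cmeasurable mf := f2.
  have Sa : (Lnorm m 2%:E (fun x => (\1_S x * Normc.normc (f x))%:E) <= a)%E.
    apply: Lnorm_le_ae => //; first exact: measurable_funM.
    apply: aeW => x; rewrite normrM ler_piMl// indicE.
    by case: (_ \in _); rewrite ?normr1 ?normr0.
  (* Hoelder on S needs the L^2 norm of 1_S f to be finite, which follows from [Sa]. *)
  have afin : (a < +oo)%E by case: f2.
  apply: le_trans (Lnorm_indic_le p0 _ mS Sfin mn (le_lt_trans Sa afin)) _.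
    by rewrite lee_fin.
  by apply: lee_wpmul2l => //; rewrite lee_fin powR_ge0.
have main : (Lnorm mh 2%:E (fun xi => (\1_Sigma xi * Normc.normc (F2 g xi))%:E) <=
    (rho * kS * kSigma)%:E * a)%E.
  apply: le_trans (restriction_L2 ev_char c0 F2P ScP p12 q2 mSigma Sigmafin
    rho0 restriction g1 g2 gp) _.
  rewrite mulrAC [X in (_ <= X * _)%E]EFinM -muleA; apply: lee_wpmul2l => //.
  by rewrite lee_fin mulr_ge0 ?powR_ge0.
(* The norm of f is computed on the dual side. On Sigma, F2 f is compared with F2 g; off Sigma it is
   the third term. The middle norm is that of f - g by isometry, that is [b]. *)
have split_norm : (a <= (rho * kS * kSigma)%:E * a + (b + e))%E.
  rewrite addeA; apply: (@le_trans _ _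
    (Lnorm mh 2%:E (fun xi => (\1_Sigma xi * Normc.normc (F2 g xi))%:E) +
     Lnorm mh 2%:E (fun xi => (Normc.normc (F2 f xi - F2 g xi))%:E) + e)%E).
    rewrite /a -(L2_fourier_norm F2P f2); apply: Lnorm_leD3_ae => //.
    - exact: ler1n.
    - exact: measurable_funM.
    - by apply: measurable_normc; apply: cmeasurableB;
        [exact: Lp_mem_cmeasurable F2f|exact: Lp_mem_cmeasurable F2g].
    - exact: measurable_funM.
    apply: aeW => xi; rewrite !ger0_norm ?mulr_ge0 ?normc_ge0//.
    rewrite !indicE in_setC; case: (xi \in Sigma).
      by rewrite !mul1r mul0r addr0 normc_sub_triangle.
    by rewrite mul0r mul1r add0r lerDr normc_ge0.
  rewrite (F2iso _ _ f2 g2) leeD2r// leeD//.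
  rewrite le_eqVlt; apply/orP; left; apply/eqP; apply: eq_Lnorm => x.
  rewrite (_ : f x - g x = (\1_(~` S) x)%:C%C * f x) ?normc_indicM//.
  rewrite /g !indicE in_setC; case: (x \in S).
    by rewrite /= mul1r mul0r subrr.
  by rewrite /= mul1r mul0r subr0.
(* Finiteness of [a] is what permits moving k a to the left and dividing by 1 - k > 0; an infinite
   right side is trivial. *)
have aE : a = (fine a)%:E := esym (Lp_mem_fineK f2).
rewrite lee_pdivlMl ?subr_gt0//; move: split_norm; rewrite aE.
case: (b + e)%E => [s| |]; rewrite ?leey//.
by rewrite -!EFinM -EFinD !lee_fin; lra.
Qed.
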